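(* For every $\omega_0\in2\pi\mathbb{Q}$ and every $0<r\le 1/3$, there is a (nondegenerate) interval $\mathcal{I}=\mathcal{I}_r$, depending on $\omega_0$, such that for every $\Omega\in\mathcal{I}_r$ the circle homeomorphism $R_{r,\Omega}$ (a diffeomorphism if $r<1/3$) has rotation number $\omega_0$.
   Context: For $r\in[0,1)$ and $\Omega\in\mathbb{R}$, the circle map $R_{r,\Omega}$ of $\mathbb{R}/2\pi\mathbb{Z}$ is given by the lift $$R_{r,\Omega}(\phi)=\phi+\Omega-2\sum_{k=1}^\infty\frac{r^k}{k}\sin(k\phi).$$ Its rotation number (for $r\le1/3$, where the map is an orientation-preserving circle homeomorphism) is $\omega(R_{r,\Omega})=\lim_{n\to\infty}\dfrac{R_{r,\Omega}^n(\phi_0)-\phi_0}{n}$, computed with this lift; it is independent of $\phi_0$. *)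

(* Defs.v *)
From Stdlib Require Import Reals ZArith QArith Qreals.
From Coquelicot Require Import Coquelicot.
Open Scope R_scope.

(* The lift of the circle map; the summation index k >= 1 is shifted to S k. *)
Definition circle_map (r Omega phi : R) : R :=
  phi + Omega
  - 2 * Series (fun k : nat => r ^ (S k) / INR (S k) * sin (INR (S k) * phi)).

(* Equality in the circle R / 2 pi Z. *)
Definition circle_eq (x y : R) : Prop :=
  exists k : Z, x = y + 2 * PI * IZR k.

(* Self-maps of R / 2 pi Z are handled through functions F : R -> R compatible
   with [circle_eq].  Since R -> R / 2 pi Z is a covering and a local
   diffeomorphism, the continuous (resp. smooth) self-maps of the circle are
   exactly those induced by a continuous (resp. smooth) compatible F. *)
Definition descends (F : R -> R) : Prop :=
  forall x y : R, circle_eq x y -> circle_eq (F x) (F y).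

Definition circle_inverse (F G : R -> R) : Prop :=
  (forall x : R, circle_eq (G (F x)) x) /\
  (forall x : R, circle_eq (F (G x)) x).

Definition smooth (F : R -> R) : Prop :=
  forall (n : nat) (x : R), ex_derive_n F n x.

Definition orientation_preserving (F : R -> R) : Prop :=
  forall x y : R, x < y -> F x < F y.

Definition circle_homeomorphism (F : R -> R) : Prop :=
  descends F /\ (forall x : R, continuous F x) /\
  exists G : R -> R,
    descends G /\ (forall x : R, continuous G x) /\ circle_inverse F G.

Definition circle_diffeomorphism (F : R -> R) : Prop :=
  descends F /\ smooth F /\
  exists G : R -> R, descends G /\ smooth G /\ circle_inverse F G.

(* The term n = 0 involves a division by zero, irrelevant for the limit. *)
Definition is_rotation_number (F : R -> R) (omega : R) : Prop :=
  forall phi0 : R,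
    is_lim_seq (fun n : nat => (Nat.iter n F phi0 - phi0) / INR n) omega.

(* Main.v *)
(* The sine series is the imaginary part of -log(1 - r z), z = e^(i phi), so the map is
   phi + Omega - 2 atan (r sin phi / (1 - r cos phi)); in the coordinate z it is the rational
   map z |-> e^(i Omega) z^2 (1 - r z) / (z - r), and it is increasing for r <= 1/3.
   Write omega0 = 2 pi p / q. A lift F with F^q x = x + 2 pi p for some x has rotation number
   omega0. By continuity in Omega there is an Omega0 with F^q 0 = 2 pi p. The rational map has
   a critical fixed point at z = 0, so its q-th iterate is not the identity, hence
   F^q - id - 2 pi p does not vanish identically at Omega0. Since F^q increases with Omega,
   a zero of F^q - id - 2 pi p then persists on a one-sided neighbourhood of Omega0. *)

Require Import Defs.
From Stdlib Require Import Reals ZArith QArith Qreals.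
From Stdlib Require Import Lra Lia Classical FunctionalExtensionality.
From Coquelicot Require Import Coquelicot.
Open Scope R_scope.

(** * The closed form of the circle map *)

Lemma CV_radius_of_bounded (a : nat -> R) (M : R) :
  (forall n, Rabs (a n) <= M) -> Rbar_le 1 (CV_radius a).
Proof.
  intros H.
  apply (proj1 (CV_radius_bounded a)).
  exists M. intros n. rewrite pow1, Rmult_1_r. apply H.
Qed.

(** The expression is the convex combination [((1 + t)^2 (1 - c) + (1 - t)^2 (1 + c)) / 2] of two
    positive squares. *)
Lemma poisson_denominator_pos (t c : R) :
  Rabs t < 1 -> -1 <= c <= 1 -> 0 < 1 - 2 * t * c + t ^ 2.
Proof.
  intros Ht Hc. apply Rabs_def2 in Ht.
  assert (0 <= (1 + t) ^ 2 * (1 - c)) by (apply Rmult_le_pos; [apply pow2_ge_0 | lra]).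
  assert (0 <= (1 - t) ^ 2 * (1 + c)) by (apply Rmult_le_pos; [apply pow2_ge_0 | lra]).
  assert (0 < (1 + t) ^ 2) by (apply pow_lt; lra).
  assert (0 < (1 - t) ^ 2) by (apply pow_lt; lra).
  destruct (Rlt_or_le c 0); nra.
Qed.

(** Both sides are the squared modulus of [1 - t e^(i phi)]. The left form is the one that
    differentiating the arctangent produces. *)
Lemma poisson_denominator_eq (t phi : R) :
  (1 - t * cos phi) ^ 2 + (t * sin phi) ^ 2 = 1 - 2 * t * cos phi + t ^ 2.
Proof.
  pose proof (sin2_cos2 phi) as SC. unfold Rsqr in SC.
  transitivity (1 - 2 * t * cos phi + t ^ 2 * (sin phi * sin phi + cos phi * cos phi)).
  - ring.
  - rewrite SC. ring.
Qed.

(** The factor in front encodes the recurrence of [sin (k phi)] in [k], with characteristic roots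
    [e^(i phi)] and [e^(-i phi)], so the product telescopes to its boundary terms. *)
Lemma sin_geometric_partial_sum (t phi : R) (n : nat) :
  (1 - 2 * t * cos phi + t ^ 2)
    * sum_n (fun k => t ^ k * sin (INR (S k) * phi)) n
  = sin phi - t ^ (S n) * sin (INR (S (S n)) * phi)
    + t ^ (S (S n)) * sin (INR (S n) * phi).
Proof.
  assert (rec : forall x, sin (x + 2 * phi) = 2 * cos phi * sin (x + phi) - sin x).
  { intros x.
    replace (x + 2 * phi) with ((x + phi) + phi) by ring.
    replace (sin x) with (sin ((x + phi) - phi)) by (f_equal; ring).
    rewrite sin_plus, sin_minus. ring. }
  induction n as [|n IH].
  - rewrite sum_O. simpl.
    replace ((1 + 1) * phi) with (2 * phi) by ring.
    rewrite !Rmult_1_l, sin_2a. ring.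
  - rewrite sum_Sn. change plus with Rplus.
    rewrite Rmult_plus_distr_l, IH.
    replace (INR (S (S (S n))) * phi) with (INR (S n) * phi + 2 * phi)
      by (rewrite !S_INR; ring).
    rewrite rec.
    replace (INR (S n) * phi + phi) with (INR (S (S n)) * phi)
      by (rewrite !S_INR; ring).
    simpl. ring.
Qed.

Lemma is_lim_seq_geom_bounded (t : R) (u : nat -> R) :
  Rabs t < 1 -> (forall n, Rabs (u n) <= 1) ->
  is_lim_seq (fun n => t ^ n * u n) 0.
Proof.
  intros Ht Hu. apply is_lim_seq_abs_0.
  apply is_lim_seq_le_le with (u := fun _ => 0) (w := fun n => Rabs t ^ n).
  - intros n. split. apply Rabs_pos.
    rewrite Rabs_mult, RPow_abs.
    specialize (Hu n). pose proof (Rabs_pos (t ^ n)). pose proof (Rabs_pos (u n)). nra.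
  - apply is_lim_seq_const.
  - apply is_lim_seq_geom. now rewrite Rabs_Rabsolu.
Qed.

Lemma abs_sin_le_1 (x : R) : Rabs (sin x) <= 1.
Proof. apply Rabs_le, SIN_bound. Qed.

Lemma sin_geometric_series (t phi : R) : Rabs t < 1 ->
  PSeries (fun k => sin (INR (S k) * phi)) t
  = sin phi / (1 - 2 * t * cos phi + t ^ 2).
Proof.
  intros Ht. apply is_pseries_unique.
  assert (D := poisson_denominator_pos t (cos phi) Ht (COS_bound phi)).
  set (d := 1 - 2 * t * cos phi + t ^ 2) in *.
  apply is_pseries_R.
  apply is_series_ext with (fun k => t ^ k * sin (INR (S k) * phi)).
  { intros k. apply Rmult_comm. }
  change (is_lim_seq (sum_n (fun k => t ^ k * sin (INR (S k) * phi))) (sin phi / d)).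
  apply is_lim_seq_ext with (fun n => (sin phi - t * (t ^ n * sin (INR (S (S n)) * phi))
      + t ^ 2 * (t ^ n * sin (INR (S n) * phi))) / d).
  { intros n. apply Rmult_eq_reg_l with d; [|lra].
    pose proof (sin_geometric_partial_sum t phi n) as P. fold d in P.
    rewrite P. simpl. field. lra. }
  replace (sin phi / d) with ((sin phi - t * 0 + t ^ 2 * 0) * / d) by (field; lra).
  apply (is_lim_seq_scal_r (fun n => sin phi - t * (t ^ n * sin (INR (S (S n)) * phi))
      + t ^ 2 * (t ^ n * sin (INR (S n) * phi))) (/ d) (Finite _)).
  apply is_lim_seq_plus'.
  apply is_lim_seq_minus'.
  - apply is_lim_seq_const.
  - apply (is_lim_seq_scal_l _ t (Finite 0)).
    apply is_lim_seq_geom_bounded; auto. intros; apply abs_sin_le_1.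
  - apply (is_lim_seq_scal_l _ (t ^ 2) (Finite 0)).
    apply is_lim_seq_geom_bounded; auto. intros; apply abs_sin_le_1.
Qed.

Lemma one_minus_mul_cos_pos (t c : R) : Rabs t < 1 -> -1 <= c <= 1 -> 0 < 1 - t * c.
Proof.
  intros Ht Hc. apply Rabs_def2 in Ht. destruct (Rlt_or_le c 0); nra.
Qed.

(** The sine geometric series is integrated term by term in the radius from 0 to [r]. Its sum is the
    derivative of the arctangent expression, which vanishes at radius 0. *)
Lemma sin_log_series (r phi : R) : 0 <= r < 1 ->
  Series (fun k => r ^ (S k) / INR (S k) * sin (INR (S k) * phi))
  = atan (r * sin phi / (1 - r * cos phi)).
Proof.
  intros Hr.
  set (b := fun k => sin (INR (S k) * phi)).
  assert (Hb : Rbar_le 1 (CV_radius b)).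
  { apply CV_radius_of_bounded with 1. intros; apply abs_sin_le_1. }
  assert (Hin : forall t, Rabs t < 1 -> Rbar_lt (Rabs t) (CV_radius b)).
  { intros t Ht. apply Rbar_lt_le_trans with 1; auto. }
  assert (Hseg : forall t, Rmin 0 r <= t <= Rmax 0 r -> Rabs t < 1).
  { intros t. rewrite Rmin_left, Rmax_right by lra. intros.
    apply Rabs_def1; lra. }
  assert (Hr1 : Rabs r < 1) by (apply Rabs_def1; lra).
  transitivity (PSeries (PS_Int b) r).
  (* [PS_Int] has constant coefficient 0. Dropping it aligns the indices with the shifted series. *)
  { rewrite PSeries_decr_1.
    2: { apply CV_radius_inside. rewrite CV_radius_Int. auto. }
    unfold PSeries, PS_decr_1, PS_Int. rewrite <- Series_scal_l, Rplus_0_l.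
    apply Series_ext. intros k. unfold b.
    assert (INR (S k) <> 0) by (apply not_0_INR; lia).
    simpl pow. field. auto. }
  rewrite <- RInt_PSeries by auto.
  apply is_RInt_unique.
  replace (atan (r * sin phi / (1 - r * cos phi)))
    with (minus (atan (r * sin phi / (1 - r * cos phi)))
                (atan (0 * sin phi / (1 - 0 * cos phi)))).
  2: { unfold minus, plus, opp; simpl.
       replace (0 * sin phi / (1 - 0 * cos phi)) with 0 by (field; lra).
       rewrite atan_0. ring. }
  apply (is_RInt_derive (fun t => atan (t * sin phi / (1 - t * cos phi)))).
  - intros t Ht. apply Hseg in Ht. unfold b.
    rewrite sin_geometric_series by auto.
    assert (D := poisson_denominator_pos t (cos phi) Ht (COS_bound phi)).
    assert (E := one_minus_mul_cos_pos t (cos phi) Ht (COS_bound phi)).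
    auto_derive. lra.
    pose proof (poisson_denominator_eq t phi) as N.
    unfold Rsqr.
    transitivity (sin phi / ((1 - t * cos phi) ^ 2 + (t * sin phi) ^ 2)).
    field. repeat split; try lra.
    now rewrite N.
  - intros t Ht. apply Hseg in Ht.
    apply continuity_pt_filterlim, PSeries_continuity. auto.
Qed.

(** * Smoothness and inverse functions *)

(** The derivative is carried as a function and peeled off from the first one on, so closure under
    products, composition and reciprocals is an induction on [n]. *)
Fixpoint differentiable_n (n : nat) (f : R -> R) : Prop :=
  match n with
  | O => True
  | S m => exists f', (forall x, is_derive f x (f' x)) /\ differentiable_n m f'
  end.

Lemma differentiable_n_pred (n : nat) (f : R -> R) :
  differentiable_n (S n) f -> differentiable_n n f.
Proof.
  revert f; induction n as [|n IH]; intros f [f' [Hf Hf']].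
  - exact I.
  - exists f'. auto.
Qed.

Lemma smooth_of_differentiable_n (f : R -> R) :
  (forall n, differentiable_n n f) -> smooth f.
Proof.
  assert (H : forall n f, differentiable_n (S n) f ->
            forall x, ex_derive (Derive_n f n) x).
  { clear f. induction n as [|n IH]; intros f [f' [Hf Hf']] x.
    - exists (f' x). apply Hf.
    - assert (E : Derive f = f').
      { apply functional_extensionality; intros y. now apply is_derive_unique. }
      assert (E2 : Derive_n f (S n) = Derive_n f' n).
      { apply functional_extensionality; intros y.
        rewrite <- E, <- Nat.add_1_r. symmetry.
        apply (Derive_n_comp f n 1). }
      rewrite E2. now apply IH. }
  intros Hf [|n] x.
  - exact I.
  - apply H, Hf.
Qed.

Lemma differentiable_n_const (c : R) (n : nat) : differentiable_n n (fun _ => c).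
Proof.
  revert c; induction n as [|n IH]; intros c; [exact I|].
  exists (fun _ => 0). split; [|apply IH].
  intros x. apply (is_derive_const c x).
Qed.

Lemma differentiable_n_plus (n : nat) (f g : R -> R) :
  differentiable_n n f -> differentiable_n n g ->
  differentiable_n n (fun x => f x + g x).
Proof.
  revert f g; induction n as [|n IH]; intros f g; [easy|].
  intros [f' [Hf Hf']] [g' [Hg Hg']].
  exists (fun x => f' x + g' x). split; [|auto].
  intros x. now apply (is_derive_plus f g).
Qed.

Lemma differentiable_n_mult (n : nat) (f g : R -> R) :
  differentiable_n n f -> differentiable_n n g ->
  differentiable_n n (fun x => f x * g x).
Proof.
  revert f g; induction n as [|n IH]; intros f g; [easy|].
  intros Hf0 Hg0.
  assert (Hfn := differentiable_n_pred _ _ Hf0).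
  assert (Hgn := differentiable_n_pred _ _ Hg0).
  destruct Hf0 as [f' [Hf Hf']], Hg0 as [g' [Hg Hg']].
  exists (fun x => f' x * g x + f x * g' x). split.
  - intros x. now apply Derive.is_derive_mult.
  - apply differentiable_n_plus; auto.
Qed.

Lemma differentiable_n_comp (n : nat) (f g : R -> R) :
  differentiable_n n f -> differentiable_n n g ->
  differentiable_n n (fun x => f (g x)).
Proof.
  revert f g; induction n as [|n IH]; intros f g; [easy|].
  intros [f' [Hf Hf']] Hg0.
  assert (Hgn := differentiable_n_pred _ _ Hg0).
  destruct Hg0 as [g' [Hg Hg']].
  exists (fun x => g' x * f' (g x)). split.
  - intros x. now apply (is_derive_comp f g).
  - apply differentiable_n_mult; auto.
Qed.

Lemma differentiable_n_inv (n : nat) (f : R -> R) :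
  (forall x, f x <> 0) -> differentiable_n n f ->
  differentiable_n n (fun x => / f x).
Proof.
  intros H0. induction n as [|n IH]; [easy|].
  intros Hf0.
  assert (Hn := IH (differentiable_n_pred _ _ Hf0)).
  destruct Hf0 as [f' [Hf Hf']].
  exists (fun x => (-1) * (f' x * (/ f x * / f x))). split.
  - intros x.
    replace (-1 * (f' x * (/ f x * / f x))) with (- f' x / f x ^ 2) by (field; auto).
    now apply is_derive_inv.
  - apply differentiable_n_mult; [apply differentiable_n_const|].
    apply differentiable_n_mult; [assumption|].
    now apply differentiable_n_mult.
Qed.

(** The two functions go together because each derivative is, up to sign, the other function. *)
Lemma differentiable_n_cos_sin (n : nat) :
  differentiable_n n cos /\ differentiable_n n sin.
Proof.
  induction n as [|n [IHc IHs]]; [easy|]. split.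
  - exists (fun x => (-1) * sin x). split.
    + intros x. replace (-1 * sin x) with (- sin x) by ring. apply is_derive_cos.
    + apply differentiable_n_mult; [apply differentiable_n_const|assumption].
  - exists cos. split; [apply is_derive_sin | assumption].
Qed.

(** Bootstrapping: the derivative [/ F' (G y)] is as regular as [G], so [G] gains one order at each
    round. *)
Lemma differentiable_n_inverse (n : nat) (F' G : R -> R) :
  (forall x, F' x <> 0) -> (forall m, differentiable_n m F') ->
  (forall y, is_derive G y (/ F' (G y))) ->
  differentiable_n n G.
Proof.
  intros H0 HF' HG. induction n as [|n IH]; [exact I|].
  exists (fun y => / F' (G y)). split; [assumption|].
  apply (differentiable_n_inv n (fun y => F' (G y))); [auto|].
  now apply differentiable_n_comp.
Qed.

Lemma continuous_eps (f : R -> R) (x : R) :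
  (forall eps, 0 < eps -> exists delta, 0 < delta /\
     forall y, Rabs (y - x) < delta -> Rabs (f y - f x) < eps) ->
  continuous f x.
Proof.
  intros H. apply filterlim_locally. intros eps.
  destruct (H eps (cond_pos eps)) as [delta [Hd Hy]].
  exists (mkposreal delta Hd). exact Hy.
Qed.

Section IncreasingInverse.

Context (F G : R -> R).
Context (F_incr : forall x y, x < y -> F x < F y).
Context (FG : forall y, F (G y) = y).

Lemma increasing_le (x y : R) : x <= y -> F x <= F y.
Proof. intros [H|H]; [left; auto | right; now f_equal]. Qed.

Lemma increasing_lt_inv (x y : R) : F x < F y -> x < y.
Proof.
  intros H. apply Rnot_le_lt. intros L. apply increasing_le in L. lra.
Qed.

Lemma increasing_inj (x y : R) : F x = F y -> x = y.
Proof.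
  intros H. destruct (Rtotal_order x y) as [L|[L|L]]; [|assumption|];
    apply F_incr in L; lra.
Qed.

Lemma inverse_of_increasing_continuous (y : R) : continuous G y.
Proof.
  apply continuous_eps. intros eps He.
  assert (H1 : F (G y - eps) < y) by (rewrite <- (FG y) at 2; apply F_incr; lra).
  assert (H2 : y < F (G y + eps)) by (rewrite <- (FG y) at 1; apply F_incr; lra).
  (* Within this radius [z] stays between the values of [F] at [G y - eps] and [G y + eps], and
     monotonicity traps [G z] between these two points. *)
  exists (Rmin (y - F (G y - eps)) (F (G y + eps) - y)). split.
  - apply Rmin_pos; lra.
  - intros z Hz.
    pose proof (Rmin_l (y - F (G y - eps)) (F (G y + eps) - y)).
    pose proof (Rmin_r (y - F (G y - eps)) (F (G y + eps) - y)).
    apply Rabs_def2 in Hz.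
    assert (G y - eps < G z) by (apply increasing_lt_inv; rewrite FG; lra).
    assert (G z < G y + eps) by (apply increasing_lt_inv; rewrite FG; lra).
    apply Rabs_def1; lra.
Qed.

(** The difference quotient of [G] at [h] is the reciprocal of that of [F] at the increment
    [G (y + h) - G y]. This increment tends to 0 by continuity of [G] and is nonzero for
    [h <> 0]. *)
Lemma inverse_of_increasing_is_derive (y l : R) :
  l <> 0 -> is_derive F (G y) l -> is_derive G y (/ l).
Proof.
  intros Hl HF.
  assert (Q : filterlim (fun h => (G (y + h) - G y) / h) (locally' 0) (locally (/ l))).
  { assert (HF' : filterlim (fun k => (F (G y + k) - F (G y)) / k)
                    (locally' 0) (locally l)).
    { apply is_derive_Reals in HF.
      apply filterlim_locally. intros eps.
      destruct (HF eps (cond_pos eps)) as [d Hd].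
      exists d. intros k Hk Hk0. apply Hd; [assumption|].
      replace k with (minus k 0); [exact Hk | unfold minus, plus, opp; simpl; ring]. }
    apply filterlim_ext_loc with
      (f := fun h => / ((F (G y + (G (y + h) - G y)) - F (G y)) / (G (y + h) - G y))).
    - exists (mkposreal 1 Rlt_0_1). intros h _ Hh.
      replace (G y + (G (y + h) - G y)) with (G (y + h)) by ring.
      rewrite !FG.
      assert (G (y + h) - G y <> 0).
      { intros E. apply Hh.
        assert (E' : G (y + h) = G y) by lra.
        apply (f_equal F) in E'. rewrite !FG in E'. lra. }
      field. repeat split; lra.
    - refine (filterlim_comp _ _ _
        (fun h => (F (G y + (G (y + h) - G y)) - F (G y)) / (G (y + h) - G y))
        Rinv (locally' 0) (locally l) (locally (/ l)) _ _).
      2: { apply (filterlim_Rbar_inv l). intros E; apply Hl. now injection E. }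
      refine (filterlim_comp _ _ _ (fun h => G (y + h) - G y)
        (fun k => (F (G y + k) - F (G y)) / k)
        (locally' 0) (locally' 0) (locally l) _ HF').
      intros P [d Hd].
      assert (C := inverse_of_increasing_continuous y).
      apply (proj1 (filterlim_locally _ _)) with (eps := d) in C.
      destruct C as [e He].
      exists e. intros h Hh Hh0. apply Hd.
      + assert (B : ball y e (y + h)).
        { unfold ball in *; simpl in *; unfold AbsRing_ball, minus, plus, opp, abs in *; simpl in *.
          replace (y + h + - y) with (h + - 0) by ring. exact Hh. }
        apply He in B.
        unfold ball in *; simpl in *; unfold AbsRing_ball, minus, plus, opp, abs in *; simpl in *.
        replace (G (y + h) - G y + - 0) with (G (y + h) + - G y) by ring. exact B.
      + intros E. assert (E' : G (y + h) = G y) by lra.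
        apply (f_equal F) in E'. rewrite !FG in E'. lra. }
  apply is_derive_Reals. intros eps He.
  apply (proj1 (filterlim_locally _ _)) with (eps := mkposreal eps He) in Q.
  destruct Q as [d Hd]. exists d. intros h Hh0 Hh.
  apply Hd; [|assumption].
  unfold ball; simpl; unfold AbsRing_ball, minus, plus, opp, abs; simpl.
  now rewrite Ropp_0, Rplus_0_r.
Qed.

End IncreasingInverse.

(** * Rotation numbers and periodic points *)

Definition degree_one (F : R -> R) : Prop :=
  forall (x : R) (k : Z), F (x + 2 * PI * IZR k) = F x + 2 * PI * IZR k.

Lemma degree_one_iter (F : R -> R) (n : nat) :
  degree_one F -> degree_one (Nat.iter n F).
Proof.
  intros HF x k. induction n as [|n IH]; simpl; [reflexivity|].
  now rewrite IH, HF.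
Qed.

Lemma increasing_iter (F : R -> R) (n : nat) :
  orientation_preserving F -> orientation_preserving (Nat.iter n F).
Proof.
  intros HF x y Hxy. induction n as [|n IH]; simpl; auto.
Qed.

Lemma continuity_iter (F : R -> R) (n : nat) :
  continuity F -> continuity (Nat.iter n F).
Proof.
  intros HF. induction n as [|n IH]; simpl.
  - apply derivable_continuous, derivable_id.
  - apply (continuity_comp (Nat.iter n F) F); assumption.
Qed.

Lemma finitely_many_bounded (u : nat -> R) (q : nat) :
  exists C, 0 <= C /\ forall n, (n < q)%nat -> Rabs (u n) <= C.
Proof.
  induction q as [|q [C [HC IH]]].
  - exists 0. split; [lra|]. intros n Hn; lia.
  - exists (Rmax C (Rabs (u q))). split.
    + apply Rle_trans with C; [assumption | apply Rmax_l].
    + intros n Hn. destruct (Nat.eq_dec n q) as [->|Hne]; [apply Rmax_r|].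
      apply Rle_trans with C; [apply IH; lia | apply Rmax_l].
Qed.

(** The deviation of the [n]-th iterate from [n omega] is bounded, hence vanishes after division by
    [n]. Along the orbit of [x0] it is periodic in [n], and every other orbit stays within a fixed
    number of turns of that one. *)
Lemma rotation_number_of_periodic_point (F : R -> R) (q : nat) (p : Z) (x0 : R) :
  orientation_preserving F -> degree_one F -> (0 < q)%nat ->
  Nat.iter q F x0 = x0 + 2 * PI * IZR p ->
  is_rotation_number F (2 * PI * (IZR p / INR q)).
Proof.
  intros Hinc Hdeg Hq Hper phi0.
  set (omega := 2 * PI * (IZR p / INR q)).
  assert (Hq0 : INR q <> 0) by (apply not_0_INR; lia).
  set (u := fun n => Nat.iter n F x0 - INR n * omega).
  assert (Hu : forall n, u (q + n)%nat = u n).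
  { intros n. unfold u. rewrite Nat.add_comm, Nat.iter_add, Hper, plus_INR.
    rewrite (degree_one_iter F n Hdeg). unfold omega. field. assumption. }
  destruct (finitely_many_bounded u q) as [C [HC HuC]].
  assert (Hbound : forall n, Rabs (u n) <= C).
  { induction n as [n IH] using (well_founded_induction lt_wf).
    destruct (Nat.lt_ge_cases n q) as [L|L]; [auto|].
    replace n with (q + (n - q))%nat by lia. rewrite Hu. apply IH. lia. }
  (* [S m] full turns exceed the distance from [phi0] to [x0]. Translating [x0] by them in both
     directions encloses [phi0], and monotone iterates that commute with turns preserve the
     enclosure. *)
  destruct (nfloor_ex (Rabs (phi0 - x0))) as [m [_ Hm]]; [apply Rabs_pos|].
  assert (PIgt1 : 1 < 2 * PI) by (pose proof PI2_1; lra).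
  set (k := Z.of_nat (S m)).
  assert (Hk : Rabs (phi0 - x0) < 2 * PI * IZR k).
  { unfold k. rewrite <- INR_IZR_INZ, S_INR.
    pose proof (pos_INR m). nra. }
  set (D := 2 * PI * IZR k).
  assert (Hclose : forall n, Rabs (Nat.iter n F phi0 - Nat.iter n F x0) <= D).
  { intros n. apply Rabs_def2 in Hk.
    assert (I := increasing_iter F n Hinc).
    assert (H1 : Nat.iter n F phi0 < Nat.iter n F (x0 + 2 * PI * IZR k))
      by (apply I; lra).
    assert (H2 : Nat.iter n F (x0 + 2 * PI * IZR (- k)) < Nat.iter n F phi0)
      by (apply I; rewrite opp_IZR; lra).
    rewrite (degree_one_iter F n Hdeg) in H1, H2. rewrite opp_IZR in H2.
    unfold D. apply Rabs_le. lra. }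
  set (K := D + C + Rabs phi0).
  assert (Hdev : forall n, Rabs (Nat.iter n F phi0 - phi0 - INR n * omega) <= K).
  { intros n.
    replace (Nat.iter n F phi0 - phi0 - INR n * omega)
      with ((Nat.iter n F phi0 - Nat.iter n F x0) + u n + - phi0) by (unfold u; ring).
    specialize (Hclose n). specialize (Hbound n).
    eapply Rle_trans; [apply Rabs_triang|]. rewrite Rabs_Ropp.
    pose proof (Rabs_triang (Nat.iter n F phi0 - Nat.iter n F x0) (u n)).
    unfold K. lra. }
  assert (Hinv : is_lim_seq (fun n => / INR n) 0).
  { replace (Finite 0) with (Rbar_inv p_infty) by reflexivity.
    apply is_lim_seq_inv; [apply is_lim_seq_INR | discriminate]. }
  apply is_lim_seq_le_le_loc with
    (u := fun n => omega - K * / INR n) (w := fun n => omega + K * / INR n).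
  - exists 1%nat. intros n Hn.
    assert (Hn0 : 0 < INR n) by (apply lt_0_INR; lia).
    assert (Hi : 0 < / INR n) by now apply Rinv_0_lt_compat.
    specialize (Hdev n). apply Rabs_le_between in Hdev.
    replace ((Nat.iter n F phi0 - phi0) / INR n)
      with (omega + (Nat.iter n F phi0 - phi0 - INR n * omega) * / INR n)
      by (field; lra).
    split; nra.
  - replace omega with (omega - K * 0) at 1 by ring.
    apply is_lim_seq_minus'; [apply is_lim_seq_const|].
    now apply (is_lim_seq_scal_l (fun n => / INR n) K 0).
  - replace omega with (omega + K * 0) at 1 by ring.
    apply is_lim_seq_plus'; [apply is_lim_seq_const|].
    now apply (is_lim_seq_scal_l (fun n => / INR n) K 0).
Qed.

Lemma continuity_iter_param (f : R -> R) (n : nat) (x : R) :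
  continuity f -> continuity (fun Omega => Nat.iter n (fun y => f y + Omega) x).
Proof.
  intros Hf. induction n as [|n IH]; simpl.
  - now apply continuity_const.
  - apply (continuity_plus (fun Omega => f (Nat.iter n (fun y => f y + Omega) x))
             (fun Omega => Omega)).
    + now apply (continuity_comp (fun Omega => Nat.iter n (fun y => f y + Omega) x) f).
    + apply derivable_continuous, derivable_id.
Qed.

Lemma iter_param_le (f : R -> R) (n : nat) (x O1 O2 : R) :
  orientation_preserving f -> O1 <= O2 ->
  Nat.iter n (fun y => f y + O1) x <= Nat.iter n (fun y => f y + O2) x.
Proof.
  intros Hf HO. induction n as [|n IH]; simpl; [lra|].
  apply (increasing_le f Hf) in IH. lra.
Qed.

Lemma continuity_sign_stable (g : R -> R) (x : R) :
  continuity g -> g x <> 0 ->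
  exists d, 0 < d /\ forall y, x - d <= y <= x + d -> 0 < g x * g y.
Proof.
  intros Hg Hx.
  destruct (Hg x (Rabs (g x))) as [d [Hd Hy]]; [now apply Rabs_pos_lt|].
  (* Halving puts the closed interval inside the open one. The case [y = x] is separate because the
     continuity hypothesis speaks of points other than [x]. *)
  exists (d / 2). split; [lra|]. intros y Hxy.
  destruct (Req_dec y x) as [->|Hne]; [now apply Rsqr_pos_lt|].
  assert (B : Rabs (g y - g x) < Rabs (g x)).
  { apply Hy. split; [split; [exact I | auto]|].
    simpl. unfold R_dist. apply Rabs_def1; lra. }
  apply Rabs_def2 in B. revert B. unfold Rabs.
  destruct (Rcase_abs (g x)); intros B; nra.
Qed.

(* At [Omega0] with [F^q 0 = 2 pi p], pick [phi1] where [F^q phi1 - phi1 - 2 pi p] has a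
   sign. That sign survives a small change of [Omega], while moving [Omega] in the direction
   opposite to it gives the same expression the other (weak) sign at [0]. *)
Lemma periodic_point_interval (f : R -> R) (M : R) (q : nat) (p : Z) :
  continuity f -> orientation_preserving f -> (forall x, Rabs (f x - x) <= M) ->
  (0 < q)%nat ->
  (forall Omega, exists x, Nat.iter q (fun y => f y + Omega) x <> x + 2 * PI * IZR p) ->
  exists a b, a < b /\ forall Omega, a <= Omega <= b ->
    exists x, Nat.iter q (fun y => f y + Omega) x = x + 2 * PI * IZR p.
Proof.
  intros Hc Hinc HM Hq Hne.
  set (g := fun Omega x => Nat.iter q (fun y => f y + Omega) x - x - 2 * PI * IZR p).
  assert (Hcx : forall Omega, continuity (g Omega)).
  { intros Omega. unfold g.
    apply (continuity_minus (fun x => Nat.iter q (fun y => f y + Omega) x - x)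
             (fun _ => 2 * PI * IZR p)); [|now apply continuity_const].
    apply (continuity_minus (Nat.iter q (fun y => f y + Omega)) (fun x => x)).
    - apply continuity_iter.
      apply (continuity_plus f (fun _ => Omega)); [assumption|].
      now apply continuity_const.
    - apply derivable_continuous, derivable_id. }
  assert (HcO : forall x, continuity (fun Omega => g Omega x)).
  { intros x. unfold g.
    apply (continuity_minus (fun Omega => Nat.iter q (fun y => f y + Omega) x - x)
             (fun _ => 2 * PI * IZR p)); [|now apply continuity_const].
    apply (continuity_minus (fun Omega => Nat.iter q (fun y => f y + Omega) x)
             (fun _ => x)); [|now apply continuity_const].
    now apply continuity_iter_param. }
  assert (Hmono : forall O1 O2 x, O1 <= O2 -> g O1 x <= g O2 x).
  { intros O1 O2 x H. pose proof (iter_param_le f q x O1 O2 Hinc H). unfold g. lra. }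
  assert (Hzero : forall Omega, (exists x, g Omega x = 0) ->
            exists x, Nat.iter q (fun y => f y + Omega) x = x + 2 * PI * IZR p).
  { intros Omega [x Hx]. exists x. unfold g in Hx. lra. }
  (* Each step advances by an amount between [Omega - M] and [Omega + M]. *)
  assert (Hgrow : forall Omega n x,
            INR n * (Omega - M) <= Nat.iter n (fun y => f y + Omega) x - x
            <= INR n * (Omega + M)).
  { intros Omega n x. induction n as [|n IH]; [simpl; lra|].
    rewrite S_INR. simpl Nat.iter.
    specialize (HM (Nat.iter n (fun y => f y + Omega) x)).
    apply Rabs_le_between in HM. lra. }
  assert (HO : exists Omega0, g Omega0 0 = 0).
  (* [w] is the advance per step that makes [p] turns in [q] steps. By the growth bounds, [g] at 0
     is nonpositive for [w - M] and nonnegative for [w + M]. *)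
  { set (w := 2 * PI * IZR p / INR q).
    assert (Hq0 : 0 < INR q) by (apply lt_0_INR; lia).
    assert (E : INR q * w = 2 * PI * IZR p) by (unfold w; field; lra).
    destruct (IVT_gen (fun Omega => g Omega 0) (w - M) (w + M) 0 (HcO 0))
      as [Omega0 [_ H0]]; [|now exists Omega0].
    pose proof (proj2 (Hgrow (w - M) q 0)). pose proof (proj1 (Hgrow (w + M) q 0)).
    assert (g (w - M) 0 <= 0) by (unfold g; lra).
    assert (0 <= g (w + M) 0) by (unfold g; lra).
    split; [eapply Rle_trans; [apply Rmin_l|] | eapply Rle_trans; [|apply Rmax_r]];
      assumption. }
  destruct HO as [Omega0 H0].
  destruct (Hne Omega0) as [phi1 H1].
  assert (H1' : g Omega0 phi1 <> 0) by (unfold g; intros E; apply H1; lra).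
  destruct (continuity_sign_stable (fun Omega => g Omega phi1) Omega0 (HcO phi1) H1')
    as [d [Hd Hsign]].
  assert (Hivt : forall Omega, g Omega 0 * g Omega phi1 <= 0 -> exists x, g Omega x = 0).
  { intros Omega H.
    destruct (IVT_gen (g Omega) 0 phi1 0 (Hcx Omega)) as [x [_ Hx]]; [|now exists x].
    unfold Rmin, Rmax. destruct (Rle_dec (g Omega 0) (g Omega phi1)); nra. }
  destruct (Rdichotomy _ _ H1') as [Hs|Hs].
  - exists Omega0, (Omega0 + d). split; [lra|].
    intros Omega HOm. apply Hzero, Hivt.
    assert (g Omega0 0 <= g Omega 0) by (apply Hmono; lra). rewrite H0 in *.
    specialize (Hsign Omega). assert (S := Hsign ltac:(lra)). nra.
  - exists (Omega0 - d), Omega0. split; [lra|].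
    intros Omega HOm. apply Hzero, Hivt.
    assert (g Omega 0 <= g Omega0 0) by (apply Hmono; lra). rewrite H0 in *.
    specialize (Hsign Omega). assert (S := Hsign ltac:(lra)). nra.
Qed.

(** * Complex polynomials *)

(* [cpoly n f]: [f] is a complex polynomial function of degree less than [n]. *)
Fixpoint cpoly (n : nat) (f : C -> C) : Prop :=
  match n with
  | O => forall z, f z = RtoC 0
  | S m => exists (c : C) (g : C -> C), cpoly m g /\ forall z, f z = (c + z * g z)%C
  end.

Definition polynomial (f : C -> C) : Prop := exists n, cpoly n f.

Lemma cpoly_zero (n : nat) : cpoly n (fun _ => RtoC 0).
Proof.
  induction n as [|n IH]; simpl; [reflexivity|].
  exists (RtoC 0), (fun _ => RtoC 0). split; [assumption|]. intros z; ring.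
Qed.

Lemma cpoly_le (n m : nat) (f : C -> C) : (n <= m)%nat -> cpoly n f -> cpoly m f.
Proof.
  revert m f; induction n as [|n IH]; intros m f Hnm Hf.
  - replace f with (fun _ : C => RtoC 0); [apply cpoly_zero|].
    apply functional_extensionality; intros z. now rewrite Hf.
  - destruct m as [|m]; [lia|].
    destruct Hf as [c [g [Hg Hf]]]. exists c, g. split; [|assumption].
    apply IH; [lia | assumption].
Qed.

Lemma cpoly_plus (n : nat) (f g : C -> C) :
  cpoly n f -> cpoly n g -> cpoly n (fun z => f z + g z)%C.
Proof.
  revert f g; induction n as [|n IH]; intros f g; simpl.
  - intros Hf Hg z. rewrite Hf, Hg. ring.
  - intros [c [f' [Hf' Hf]]] [d [g' [Hg' Hg]]].
    exists (c + d)%C, (fun z => f' z + g' z)%C. split; [auto|].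
    intros z. rewrite Hf, Hg. ring.
Qed.

Lemma cpoly_scal (n : nat) (a : C) (f : C -> C) :
  cpoly n f -> cpoly n (fun z => a * f z)%C.
Proof.
  revert f; induction n as [|n IH]; intros f; simpl.
  - intros Hf z. rewrite Hf. ring.
  - intros [c [f' [Hf' Hf]]].
    exists (a * c)%C, (fun z => a * f' z)%C. split; [auto|].
    intros z. rewrite Hf. ring.
Qed.

Lemma polynomial_const (c : C) : polynomial (fun _ => c).
Proof.
  exists 1%nat, c, (fun _ => RtoC 0). split; [apply cpoly_zero|]. intros z; ring.
Qed.

Lemma polynomial_id : polynomial (fun z => z).
Proof.
  destruct (polynomial_const (RtoC 1)) as [n Hn].
  exists (S n), (RtoC 0), (fun _ => RtoC 1). split; [assumption|]. intros z; ring.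
Qed.

Lemma polynomial_plus (f g : C -> C) :
  polynomial f -> polynomial g -> polynomial (fun z => f z + g z)%C.
Proof.
  intros [n Hf] [m Hg]. exists (Nat.max n m).
  apply cpoly_plus; eapply cpoly_le; try eassumption; lia.
Qed.

Lemma polynomial_mult (f g : C -> C) :
  polynomial f -> polynomial g -> polynomial (fun z => f z * g z)%C.
Proof.
  intros [n Hf] Hg. revert f Hf; induction n as [|n IH]; intros f Hf.
  - exists O. intros z. rewrite Hf. ring.
  - destruct Hf as [c [f' [Hf' Hf]]].
    replace (fun z => f z * g z)%C with (fun z => c * g z + z * (f' z * g z))%C
      by (apply functional_extensionality; intros z; rewrite Hf; ring).
    apply polynomial_plus.
    + destruct Hg as [m Hg]. exists m. now apply cpoly_scal.
    + destruct (IH f' Hf') as [k Hk].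
      exists (S k), (RtoC 0), (fun z => f' z * g z)%C. split; [assumption|].
      intros z; ring.
Qed.

Lemma polynomial_minus_scal (a : C) (f g : C -> C) :
  polynomial f -> polynomial g -> polynomial (fun z => f z - a * g z)%C.
Proof.
  intros Hf [m Hg].
  replace (fun z => f z - a * g z)%C with (fun z => f z + (- a) * g z)%C
    by (apply functional_extensionality; intros z; ring).
  apply polynomial_plus; [assumption|]. exists m. now apply cpoly_scal.
Qed.

(** Synthetic division in Horner form: if [f z = c + z h z] and [h] has quotient [k] by [z - a],
    then [f] has quotient [h a + z k z]. *)
Lemma cpoly_factor (n : nat) (f : C -> C) (a : C) :
  cpoly (S n) f ->
  exists g, cpoly n g /\ forall z, (f z = f a + (z - a) * g z)%C.
Proof.
  revert f; induction n as [|n IH]; intros f [c [h [Hh Hf]]].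
  - exists h. split; [assumption|]. intros z. rewrite !Hf, !Hh. ring.
  - destruct (IH h Hh) as [k [Hk Ek]].
    exists (fun z => h a + z * k z)%C. split.
    + exists (h a), k. split; [assumption | reflexivity].
    + intros z. rewrite (Hf z), (Hf a), (Ek z). ring.
Qed.

Lemma polynomial_infinitely_many_roots (f : C -> C) (a : nat -> C) :
  polynomial f -> (forall i j, i <> j -> a i <> a j) ->
  (forall i, f (a i) = RtoC 0) -> forall z, f z = RtoC 0.
Proof.
  intros [n Hf] Ha. revert f Hf.
  (* Asking for roots only from index [m] on lets the induction divide out [a m] and continue with
     the tail from [S m]. *)
  assert (H : forall m f, cpoly n f -> (forall i, (m <= i)%nat -> f (a i) = RtoC 0) ->
            forall z, f z = RtoC 0).
  { induction n as [|n IH]; intros m f Hf Hr; [exact Hf|].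
    destruct (cpoly_factor n f (a m) Hf) as [g [Hg E]].
    rewrite (Hr m) in E by lia.
    assert (G : forall z, g z = RtoC 0).
    { apply (IH (S m)); [assumption|]. intros i Hi.
      specialize (E (a i)). rewrite (Hr i) in E by lia.
      destruct (Ceq_dec (g (a i)) (RtoC 0)) as [|N]; [assumption|exfalso].
      apply (Cmult_neq_0 (a i - a m) (g (a i))); [|assumption|].
      - apply Cminus_eq_contra, Ha. lia.
      - rewrite Cplus_0_l in E. now rewrite <- E. }
    intros z. rewrite E, G. ring. }
  intros f Hf Hr. apply (H O); auto.
Qed.

(** * The unit circle *)

Definition cis (x : R) : C := (cos x, sin x).

Lemma cis_plus (x y : R) : cis (x + y) = (cis x * cis y)%C.
Proof.
  unfold cis, Cmult; simpl. rewrite cos_plus, sin_plus. f_equal. ring.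
Qed.

Lemma cis_period (x : R) (k : Z) : cis (x + 2 * PI * IZR k) = cis x.
Proof.
  assert (P : forall (m : nat) y, cis (y + 2 * PI * INR m) = cis y).
  { intros m y. unfold cis.
    replace (y + 2 * PI * INR m) with (y + 2 * INR m * PI) by ring.
    now rewrite cos_period, sin_period. }
  destruct (Z_le_dec 0 k) as [L|L].
  - rewrite <- (Z2Nat.id k), <- INR_IZR_INZ by lia. apply P.
  - rewrite <- (P (Z.to_nat (- k)) (x + 2 * PI * IZR k)).
    f_equal. rewrite INR_IZR_INZ, Z2Nat.id, opp_IZR by lia. ring.
Qed.

Lemma polynomial_zero_on_circle (f : C -> C) :
  polynomial f -> (forall x, f (cis x) = RtoC 0) -> forall z, f z = RtoC 0.
Proof.
  intros Hf Hx.
  (* These points are pairwise distinct, as their imaginary parts are the reciprocals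
     [/ INR (S i)]. *)
  apply (polynomial_infinitely_many_roots f (fun i => cis (asin (/ INR (S i))))); auto.
  intros i j Hij E. apply Hij.
  apply (f_equal snd) in E. simpl snd in E.
  assert (B : forall k, -1 <= / INR (S k) <= 1).
  { intros k. assert (1 <= INR (S k)) by (rewrite S_INR; pose proof (pos_INR k); lra).
    assert (0 < / INR (S k)) by (apply Rinv_0_lt_compat; lra).
    split; [lra|]. rewrite <- Rinv_1. apply Rinv_le_contravar; lra. }
  rewrite !sin_asin in E by apply B.
  apply Rinv_eq_reg, (INR_eq (S i) (S j)) in E. lia.
Qed.

(** For [t = tan theta], [1 + i t] is a positive multiple of [e^(i theta)], so rotating it by
    [-2 theta] gives its conjugate. *)
Lemma cis_two_atan (t : R) :
  ((1 + Ci * t) * cis (- (2 * atan t)) = 1 - Ci * t)%C.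
Proof.
  unfold cis. rewrite cos_neg, sin_neg, cos_2a, sin_2a, sin_atan, cos_atan.
  assert (P : 0 < 1 + Rsqr t) by (pose proof (Rle_0_sqr t); lra).
  assert (S1 : sqrt (1 + Rsqr t) <> 0) by (apply Rgt_not_eq, sqrt_lt_R0; assumption).
  assert (S2 := sqrt_sqrt (1 + Rsqr t) ltac:(lra)).
  set (s := sqrt (1 + Rsqr t)) in *.
  assert (A : 1 / s * (1 / s) - t / s * (t / s) = (1 - t * t) / (1 + t * t)).
  { unfold Rsqr in *. transitivity ((1 - t * t) / (s * s)); [now field|]. now rewrite S2. }
  assert (B : 2 * (t / s) * (1 / s) = 2 * t / (1 + t * t)).
  { unfold Rsqr in *. transitivity (2 * t / (s * s)); [now field|]. now rewrite S2. }
  rewrite A, B. unfold Rsqr in P.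
  unfold Cminus, Copp, Cplus, Cmult, Ci, RtoC; simpl.
  f_equal; field; lra.
Qed.

(** * The lift of the circle map *)

Definition lift (r x : R) : R := x - 2 * atan (r * sin x / (1 - r * cos x)).

Lemma circle_map_lift (r Omega : R) : 0 <= r < 1 ->
  circle_map r Omega = (fun x => lift r x + Omega).
Proof.
  intros Hr. apply functional_extensionality; intros x.
  unfold circle_map, lift. rewrite sin_log_series by assumption. ring.
Qed.

Lemma cis_lift (r Omega x : R) : 0 <= r < 1 ->
  (cis (lift r x + Omega) * (cis x - r)
   = cis Omega * (cis x * cis x) * (1 - r * cis x))%C.
Proof.
  intros Hr. unfold lift.
  assert (Hk : 0 < 1 - r * cos x)
    by (apply one_minus_mul_cos_pos; [apply Rabs_def1; lra | apply COS_bound]).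
  set (t := r * sin x / (1 - r * cos x)).
  assert (Ht : (1 - r * cos x) * t = r * sin x) by (unfold t; field; lra).
  assert (E1 : (cis x - r = cis x * ((1 - r * cos x)%R * (1 + Ci * t)))%C).
  { replace ((1 - r * cos x)%R * (1 + Ci * t))%C with ((1 - r * cos x, r * sin x) : C).
    - assert (SC := sin2_cos2 x). unfold Rsqr in SC.
      unfold cis, Cminus, Copp, Cplus, Cmult, RtoC; simpl. f_equal.
      + transitivity (cos x - r * (sin x * sin x + cos x * cos x)); [rewrite SC|]; ring.
      + ring.
    - rewrite <- Ht. unfold Cplus, Cmult, Ci, RtoC; simpl. f_equal; ring. }
  assert (E2 : (1 - r * cis x = (1 - r * cos x)%R * (1 - Ci * t))%C).
  { unfold cis, Cminus, Copp, Cplus, Cmult, Ci, RtoC; simpl. f_equal; [ring|].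
    rewrite Rmult_0_l, Rplus_0_r. lra. }
  rewrite E1, E2.
  replace (x - 2 * atan t + Omega) with (x + (- (2 * atan t) + Omega)) by ring.
  rewrite !cis_plus.
  transitivity (cis Omega * (cis x * cis x) * ((1 - r * cos x)%R
     * ((1 + Ci * t) * cis (- (2 * atan t)))))%C; [ring|].
  rewrite cis_two_atan. reflexivity.
Qed.

(* Numerator and denominator of the [n]-th iterate of [z |-> a z^2 (1 - r z) / (z - r)],
   which is the circle map in the coordinate [z = e^(i phi)], with [a = e^(i Omega)]. *)
Fixpoint iterate_fraction (a r : C) (n : nat) (z : C) : C * C :=
  match n with
  | O => (z, RtoC 1)
  | S m => let (P, Q) := iterate_fraction a r m z in
           (a * (P * P) * (Q - r * P), Q * Q * (P - r * Q))%C
  end.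

Lemma iterate_fraction_spec (r Omega x : R) (n : nat) : 0 <= r < 1 ->
  (cis (Nat.iter n (fun y => lift r y + Omega)%R x)
   * snd (iterate_fraction (cis Omega) r n (cis x))
   = fst (iterate_fraction (cis Omega) r n (cis x)))%C.
Proof.
  intros Hr. induction n as [|n IH]; simpl.
  - ring.
  - destruct (iterate_fraction (cis Omega) r n (cis x)) as [P Q]. simpl in *.
    set (y := Nat.iter n (fun y => lift r y + Omega) x) in *.
    assert (E := cis_lift r Omega y Hr). rewrite <- IH.
    (* Substituting [P = cis y * Q] extracts the factor [Q^3] from both the new numerator and the
       new denominator. *)
    transitivity (Q * Q * Q * (cis (lift r y + Omega) * (cis y - r)))%C; [ring|].
    rewrite E. ring.
Qed.

(** The factor [z] of the numerator records that 0 is fixed. The next iteration squares it, which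
    makes the fixed point critical. *)
Lemma iterate_fraction_polynomial (a r : C) (n : nat) :
  (exists T, polynomial T /\ forall z, fst (iterate_fraction a r n z) = (z * T z)%C) /\
  polynomial (fun z => fst (iterate_fraction a r n z)) /\
  polynomial (fun z => snd (iterate_fraction a r n z)).
Proof.
  induction n as [|n [[T [HT ET]] [HP HQ]]]; simpl.
  - repeat split.
    + exists (fun _ => RtoC 1). split; [apply polynomial_const|]. intros z; ring.
    + apply polynomial_id.
    + apply polynomial_const.
  - set (P := fun z => fst (iterate_fraction a r n z)) in *.
    set (Q := fun z => snd (iterate_fraction a r n z)) in *.
    assert (E : forall z, (let (P0, Q0) := iterate_fraction a r n z in
        (a * (P0 * P0) * (Q0 - r * P0), Q0 * Q0 * (P0 - r * Q0))%C)
      = (a * (P z * P z) * (Q z - r * P z), Q z * Q z * (P z - r * Q z))%C).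
    { intros z. unfold P, Q. now destruct (iterate_fraction a r n z). }
    split; [|split].
    + exists (fun z => a * (T z * P z) * (Q z - r * P z))%C. split.
      * repeat apply polynomial_mult; try assumption; [apply polynomial_const|].
        now apply polynomial_minus_scal.
      * intros z. rewrite E. simpl.
        change (fst (iterate_fraction a r n z)) with (P z) in *.
        assert (ETz : P z = (z * T z)%C) by apply ET.
        rewrite ETz. ring.
    + replace (fun z : C => fst (let (P0, Q0) := iterate_fraction a r n z in
        (a * (P0 * P0) * (Q0 - r * P0), Q0 * Q0 * (P0 - r * Q0))%C))
        with (fun z => a * (P z * P z) * (Q z - r * P z))%C
        by (apply functional_extensionality; intros z; now rewrite E).
      repeat apply polynomial_mult; try assumption; [apply polynomial_const|].
      now apply polynomial_minus_scal.
    + replace (fun z : C => snd (let (P0, Q0) := iterate_fraction a r n z in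
        (a * (P0 * P0) * (Q0 - r * P0), Q0 * Q0 * (P0 - r * Q0))%C))
        with (fun z => Q z * Q z * (P z - r * Q z))%C
        by (apply functional_extensionality; intros z; now rewrite E).
      repeat apply polynomial_mult; try assumption.
      now apply polynomial_minus_scal.
Qed.

(** Where [P = 0], the recursion for the denominator becomes [Q |-> - r Q^3], which preserves being
    nonzero. *)
Lemma iterate_fraction_at_0 (a r : C) (n : nat) : r <> RtoC 0 ->
  fst (iterate_fraction a r n 0) = RtoC 0 /\ snd (iterate_fraction a r n 0) <> RtoC 0.
Proof.
  intros Hr. induction n as [|n [HP HQ]]; simpl.
  - split; [reflexivity | apply C1_nz].
  - destruct (iterate_fraction a r n 0) as [P Q]; simpl in *. subst P. split.
    + ring.
    + replace (Q * Q * (0 - r * Q))%C with (Q * Q * (- r * Q))%C by ring.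
      repeat apply Cmult_neq_0; try assumption.
      intros E. apply Hr. replace r with (- - r)%C by ring. rewrite E. ring.
Qed.

(* [0] is a critical fixed point of the rational map, so none of its iterates is the
   identity near [0]; by the identity theorem none is on the unit circle. *)
Lemma iter_lift_not_translation (r Omega : R) (q : nat) (p : Z) :
  0 < r < 1 -> (0 < q)%nat ->
  exists x, Nat.iter q (fun y => lift r y + Omega) x <> x + 2 * PI * IZR p.
Proof.
  intros Hr Hq. apply not_all_not_ex. intros Hall.
  destruct q as [|q]; [lia|].
  set (a := cis Omega).
  destruct (iterate_fraction_polynomial a r q) as [[T [HT ET]] [HP HQ]].
  destruct (iterate_fraction_polynomial a r (S q)) as [_ [_ HQ1]].
  assert (Hr0 : RtoC r <> RtoC 0) by (intros E; apply RtoC_inj in E; lra).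
  destruct (iterate_fraction_at_0 a r (S q) Hr0) as [_ N].
  apply N.
  set (U := fun z => (a * (T z * T z) * (snd (iterate_fraction a r q z)
                        - r * fst (iterate_fraction a r q z)))%C).
  assert (HS : polynomial U).
  { unfold U. repeat apply polynomial_mult; try assumption; [apply polynomial_const|].
    now apply polynomial_minus_scal. }
  assert (ES : forall z, fst (iterate_fraction a r (S q) z) = (z * (z * U z))%C).
  { intros z. unfold U. specialize (ET z). simpl.
    destruct (iterate_fraction a r q z) as [P Q]. simpl in *. rewrite ET. ring. }
  (* If the iterate were a translation by full turns, cancelling [z] would give denominator equal to
     [z U z] on the circle, hence everywhere. At [z = 0] the denominator would then vanish. *)
  assert (Z0 : forall z, (snd (iterate_fraction a r (S q) z) - 1 * (z * U z) = 0)%C).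
  { apply polynomial_zero_on_circle.
    - apply polynomial_minus_scal; [assumption|].
      apply polynomial_mult; [apply polynomial_id | assumption].
    - intros x.
      assert (E := iterate_fraction_spec r Omega x (S q) ltac:(lra)). fold a in E.
      specialize (Hall x). apply NNPP in Hall. rewrite Hall, cis_period, ES in E.
      assert (Hz : cis x <> RtoC 0).
      { intros E0. assert (E1 := cis_plus x (- x)). rewrite E0, Rplus_opp_r in E1.
        unfold cis at 1 in E1. rewrite cos_0, sin_0 in E1.
        apply C1_nz. transitivity (0 * cis (- x))%C; [exact E1 | ring]. }
      assert (E2 : (snd (iterate_fraction a r (S q) (cis x)) = cis x * U (cis x))%C).
      { transitivity (/ cis x * (cis x * snd (iterate_fraction a r (S q) (cis x))))%C.
        - now field.
        - rewrite E. now field. }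
      rewrite E2. ring. }
  specialize (Z0 (RtoC 0)).
  transitivity (snd (iterate_fraction a r (S q) 0) - 1 * (0 * U 0))%C; [ring|].
  exact Z0.
Qed.

(** * Derivative, monotonicity and inverse of the lift *)

Definition lift_derivative (r x : R) : R :=
  (1 - 4 * r * cos x + 3 * r ^ 2) * / (1 - 2 * r * cos x + r ^ 2).

Lemma lift_is_derive (r Omega x : R) : 0 <= r < 1 ->
  is_derive (fun x => lift r x + Omega) x (lift_derivative r x).
Proof.
  intros Hr. unfold lift, lift_derivative.
  assert (Hr1 : Rabs r < 1) by (apply Rabs_def1; lra).
  assert (D := poisson_denominator_pos r (cos x) Hr1 (COS_bound x)).
  assert (K := one_minus_mul_cos_pos r (cos x) Hr1 (COS_bound x)).
  auto_derive; [lra|].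
  assert (SC := sin2_cos2 x). unfold Rsqr in SC.
  pose proof (poisson_denominator_eq r x) as N.
  (* The sum of squares stays unreduced here, so that the comparison with the computed derivative is
     a pure field identity. *)
  transitivity (1 - 2 * (r * cos x - r ^ 2 * (sin x * sin x + cos x * cos x))
                  / ((1 - r * cos x) ^ 2 + (r * sin x) ^ 2)).
  - unfold Rsqr. field. repeat split; lra.
  - rewrite SC, N. field. lra.
Qed.

Lemma lift_continuity (r Omega : R) : 0 <= r < 1 ->
  continuity (fun x => lift r x + Omega).
Proof.
  intros Hr x. apply continuity_pt_filterlim.
  apply (ex_derive_continuous (fun x => lift r x + Omega) x).
  exists (lift_derivative r x). now apply lift_is_derive.
Qed.

(** The numerator is [(1 - r) (1 - 3 r) + 4 r (1 - cos x)], a sum of two nonnegative terms. The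
    first vanishes at [r = 1/3], the second where [cos x = 1]. *)
Lemma lift_derivative_pos (r x : R) :
  0 < r <= 1 / 3 -> (r < 1 / 3 \/ cos x <> 1) -> 0 < lift_derivative r x.
Proof.
  intros Hr H. unfold lift_derivative.
  apply Rmult_lt_0_compat.
  - pose proof (COS_bound x) as [_ B].
    replace (1 - 4 * r * cos x + 3 * r ^ 2)
      with ((1 - r) * (1 - 3 * r) + 4 * r * (1 - cos x)) by ring.
    assert (0 <= (1 - r) * (1 - 3 * r)) by (apply Rmult_le_pos; lra).
    assert (0 <= r * (1 - cos x)) by (apply Rmult_le_pos; lra).
    destruct H as [H|H].
    + assert (0 < (1 - r) * (1 - 3 * r)) by (apply Rmult_lt_0_compat; lra). lra.
    + assert (0 < r * (1 - cos x)) by (apply Rmult_lt_0_compat; lra). lra.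
  - apply Rinv_0_lt_compat, poisson_denominator_pos; [apply Rabs_def1; lra | apply COS_bound].
Qed.

Lemma lift_derivative_nonneg (r x : R) : 0 < r <= 1 / 3 -> 0 <= lift_derivative r x.
Proof.
  intros Hr. destruct (Req_dec (cos x) 1) as [E|E].
  - unfold lift_derivative. rewrite E.
    apply Rmult_le_pos; [nra|].
    left. apply Rinv_0_lt_compat, poisson_denominator_pos; [apply Rabs_def1|]; lra.
  - left. apply lift_derivative_pos; auto.
Qed.

Lemma cos_eq_1_separated (x y : R) : x < y < x + PI -> cos x = 1 -> cos y <> 1.
Proof.
  intros Hxy Hx Hy.
  assert (S : sin x = 0).
  { pose proof (sin2_cos2 x) as SC. unfold Rsqr in SC. rewrite Hx in SC. nra. }
  assert (C1 : cos (y - x) = 1) by (rewrite cos_minus, Hx, Hy, S; ring).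
  assert (L : cos (y - x) < cos 0) by (apply cos_decreasing_1; lra).
  rewrite cos_0 in L. lra.
Qed.

(* At [r = 1/3] the derivative vanishes at the isolated points of [2 pi Z]. *)
Lemma lift_increasing (r Omega : R) : 0 < r <= 1 / 3 ->
  orientation_preserving (fun x => lift r x + Omega).
Proof.
  intros Hr. set (F := fun x => lift r x + Omega).
  assert (MVT : forall x y, x < y -> exists c, x < c < y /\
                F y - F x = lift_derivative r c * (y - x)).
  { intros x y Hxy.
    destruct (MVT_cor2 F (lift_derivative r) x y Hxy) as [c [E Hc]].
    - intros c _. apply is_derive_Reals, lift_is_derive. lra.
    - exists c. auto. }
  assert (weak : forall x y, x < y -> F x <= F y).
  { intros x y Hxy. destruct (MVT x y Hxy) as [c [_ E]].
    pose proof (lift_derivative_nonneg r c Hr).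
    assert (0 <= lift_derivative r c * (y - x)) by (apply Rmult_le_pos; lra). lra. }
  (* The mean value theorem on each half gives points [c < d] less than [PI] apart. They cannot both
     have cosine 1, so at least one half contributes a positive increment. *)
  assert (strict : forall x y, x < y -> x < y <= x + PI -> F x < F y).
  { intros x y Hxy HPI.
    set (m := (x + y) / 2).
    destruct (MVT x m) as [c [Hc Ec]]; [unfold m; lra|].
    destruct (MVT m y) as [d [Hd Ed]]; [unfold m; lra|].
    pose proof (lift_derivative_nonneg r c Hr) as Nc.
    pose proof (lift_derivative_nonneg r d Hr) as Nd.
    assert (Pos : 0 < lift_derivative r c \/ 0 < lift_derivative r d).
    { destruct (Req_dec (cos c) 1) as [E|E].
      - right. apply lift_derivative_pos; [assumption|]. right.
        apply cos_eq_1_separated with c; [lra | assumption].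
      - left. apply lift_derivative_pos; auto. }
    assert (0 < m - x) by (unfold m; lra). assert (0 < y - m) by (unfold m; lra).
    destruct Pos; nra. }
  intros x y Hxy. pose proof PI_RGT_0.
  destruct (Rle_or_lt y (x + PI)).
  - apply strict; lra.
  - apply Rlt_le_trans with (F (x + PI)); [apply strict | apply weak]; lra.
Qed.

Lemma lift_degree_one (r Omega : R) : degree_one (fun x => lift r x + Omega).
Proof.
  intros x k. unfold lift.
  assert (E := cis_period x k). unfold cis in E. injection E as Ec Es.
  rewrite Ec, Es. ring.
Qed.

Lemma lift_close_to_id (r x : R) : Rabs (lift r x - x) <= PI.
Proof.
  unfold lift. pose proof (atan_bound (r * sin x / (1 - r * cos x))).
  apply Rabs_le. lra.
Qed.

Lemma lift_differentiable_n (r Omega : R) (n : nat) : 0 <= r < 1 ->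
  differentiable_n n (lift_derivative r) /\
  differentiable_n n (fun x => lift r x + Omega).
Proof.
  intros Hr.
  assert (A : forall m a b c, differentiable_n m (fun x => a - b * cos x + c)).
  { intros m a b c.
    replace (fun x => a - b * cos x + c) with (fun x => (a + c) + (- b) * cos x)
      by (apply functional_extensionality; intros; ring).
    apply differentiable_n_plus; [apply differentiable_n_const|].
    apply differentiable_n_mult; [apply differentiable_n_const|].
    apply differentiable_n_cos_sin. }
  assert (B : forall m, differentiable_n m (lift_derivative r)).
  { intros m. unfold lift_derivative.
    apply differentiable_n_mult; [apply A|]. apply differentiable_n_inv; [|apply A].
    intros x. apply Rgt_not_eq, poisson_denominator_pos;
      [apply Rabs_def1; lra | apply COS_bound]. }
  split; [apply B|]. destruct n as [|n]; [exact I|].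
  exists (lift_derivative r). split; [|apply B].
  intros x. now apply lift_is_derive.
Qed.

Lemma degree_one_descends (F : R -> R) : degree_one F -> descends F.
Proof. intros HF x y [k ->]. exists k. apply HF. Qed.

Lemma lift_inverse (r Omega : R) : 0 < r <= 1 / 3 ->
  exists G, degree_one G /\ (forall x, G (lift r x + Omega) = x) /\
            (forall y, lift r (G y) + Omega = y).
Proof.
  intros Hr. set (F := fun x => lift r x + Omega).
  assert (Hinc := lift_increasing r Omega Hr).
  assert (Hdeg := lift_degree_one r Omega).
  (* [F] differs from translation by [Omega] by at most [PI], so [y - Omega - PI] and
     [y - Omega + PI] bracket a preimage. [IVT_gen] delivers it as data, from which [G] is read off
     by projection. *)
  assert (surj : forall y, {x | F x = y}).
  { intros y.
    destruct (IVT_gen F (y - Omega - PI) (y - Omega + PI) y) as [x [_ Hx]].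
    - apply lift_continuity. lra.
    - pose proof (lift_close_to_id r (y - Omega - PI)) as H1.
      pose proof (lift_close_to_id r (y - Omega + PI)) as H2.
      apply Rabs_le_between in H1, H2. unfold F.
      split; [eapply Rle_trans; [apply Rmin_l|] | eapply Rle_trans; [|apply Rmax_r]]; lra.
    - now exists x. }
  set (G := fun y => proj1_sig (surj y)).
  assert (FG : forall y, F (G y) = y) by (intros y; apply (proj2_sig (surj y))).
  exists G. split; [|split].
  - intros y k. apply (increasing_inj F Hinc).
    rewrite FG. unfold F. rewrite (Hdeg (G y) k). fold (F (G y)). now rewrite FG.
  - intros x. apply (increasing_inj F Hinc). apply FG.
  - exact FG.
Qed.

Theorem theorem5p1 (omega0 : R)
    (homega0 : exists q : Q, omega0 = 2 * PI * Q2R q)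
    (r : R) (hr : 0 < r <= 1 / 3) :
  exists a b : R, a < b /\
    forall Omega : R, a <= Omega <= b ->
      circle_homeomorphism (circle_map r Omega) /\
      orientation_preserving (circle_map r Omega) /\
      (r < 1 / 3 -> circle_diffeomorphism (circle_map r Omega)) /\
      is_rotation_number (circle_map r Omega) omega0.
Proof.
  destruct homega0 as [[p q] ->].
  assert (hr1 : 0 <= r < 1) by lra.
  assert (Hq : (0 < Pos.to_nat q)%nat) by apply Pos2Nat.is_pos.
  assert (Hlift : (fun x => lift r x + 0) = lift r)
    by (apply functional_extensionality; intros; ring).
  destruct (periodic_point_interval (lift r) PI (Pos.to_nat q) p) as [a [b [Hab H]]].
  - rewrite <- Hlift. now apply lift_continuity.
  - rewrite <- Hlift. now apply lift_increasing.
  - apply lift_close_to_id.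
  - assumption.
  - intros Omega. apply iter_lift_not_translation; [lra | assumption].
  - exists a, b. split; [assumption|]. intros Omega HOm.
    rewrite (circle_map_lift r Omega hr1).
    assert (Hinc := lift_increasing r Omega hr).
    assert (Hdeg := lift_degree_one r Omega).
    destruct (lift_inverse r Omega hr) as [G [HG [GF FG]]].
    assert (Hinv : circle_inverse (fun x => lift r x + Omega) G).
    (* [G] inverts the lift on the line itself, so the circle equalities hold with zero turns. *)
    { split; intros x; exists 0%Z; rewrite ?GF, ?FG; ring. }
    split; [|split; [assumption|split]].
    + split; [now apply degree_one_descends|]. split.
      * intros x. apply continuity_pt_filterlim, lift_continuity. assumption.
      * exists G. split; [now apply degree_one_descends|]. split; [|assumption].
        intros y. now apply (inverse_of_increasing_continuous _ G Hinc FG).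
    + intros Hr3. split; [now apply degree_one_descends|]. split.
      * apply smooth_of_differentiable_n. intros n. now apply lift_differentiable_n.
      * exists G. split; [now apply degree_one_descends|]. split; [|assumption].
        assert (H0 : forall x, lift_derivative r x <> 0).
        { intros x. apply Rgt_not_eq, lift_derivative_pos; auto. }
        apply smooth_of_differentiable_n. intros n.
        apply (differentiable_n_inverse n (lift_derivative r)).
        -- assumption.
        -- intros m. now apply (lift_differentiable_n r 0).
        -- intros y. apply (inverse_of_increasing_is_derive _ G Hinc FG).
           ++ apply H0.
           ++ now apply lift_is_derive.
    + destruct (H Omega HOm) as [x0 Hx0].
      (* The denominator of the fraction serves as the number of iterations, hence its passage from
         [positive] to [nat]. *)
      replace (2 * PI * Q2R (p # q)) with (2 * PI * (IZR p / INR (Pos.to_nat q))).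
      * now apply rotation_number_of_periodic_point with x0.
      * unfold Q2R. simpl. now rewrite INR_IZR_INZ, positive_nat_Z.
Qed.
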